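(* The groups $\mathbb{Z}_8\times\mathbb{Z}_4$ and $\mathbb{Z}_4^2\times\mathbb{Z}_2$ have the PT property.
   Context: $\mathbb{Z}_N$ denotes the cyclic group of order $N$. For a finite abelian group $G$ (written additively), a pair $(\Omega,T)$ of subsets of $G$ is a tiling pair if every $g\in G$ can be written uniquely as $g=\omega+t$ with $\omega\in\Omega$, $t\in T$. A nonempty subset $A\subset G$ is periodic if there is a nonzero $g\in G$ with $A+g=A$. $G$ has the periodic tiling property (PT property) if for every tiling pair $(\Omega,T)$ of $G$, either $\Omega$ is periodic, or there is a periodic set $T'\subset G$ such that $(\Omega,T')$ is also a tiling pair. *)

(* Defs.v *)
From HB Require Import structures.
From mathcomp Require Import all_boot all_algebra.

Set Implicit Arguments.
Unset Strict Implicit.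
Unset Printing Implicit Defensive.

Import GRing.Theory.
Local Open Scope ring_scope.

(* The library equips U * V with the componentwise zmodType and finType
   structures, but does not declare their join. *)
HB.instance Definition _ (U V : finZmodType) :=
  GRing.Zmodule.on (U * V)%type.

Definition tiling_pair (G : finZmodType) (Omega T : {set G}) : Prop :=
  forall g : G, exists! p : G * G,
    [/\ p.1 \in Omega, p.2 \in T & g = p.1 + p.2].

Definition periodic (G : finZmodType) (A : {set G}) : Prop :=
  A != set0 /\ exists2 g : G, g != 0 & [set a + g | a in A] = A.

Definition PT_property (G : finZmodType) : Prop :=
  forall Omega T : {set G}, tiling_pair Omega T ->
    periodic Omega \/ exists2 T' : {set G}, periodic T' & tiling_pair Omega T'.

(* Main.v *)
(** Comparing cardinals, the factors of a tiling of a group of order 32 have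
sizes {1, 32}, {2, 16} or {4, 8}.  If [A = {x, y}] tiles with [B], then [B + x]
and [B + y] are complementary, so [B + 2(x - y) = B]: either [2(x - y)] is a
period of [B], or it vanishes and [x - y] is a period of [A].  The factors of
sizes 4 and 8 are settled by an exact cover search over all 4-element sets [S]
containing 0: a non-periodic [S] that tiles has a periodic complement, and every
non-periodic complement of [S] also tiles with the cyclic subgroup of order 4
generated by some element of [S]. *)
Require Import Defs.
From mathcomp Require Import all_boot all_algebra zify.

Set Implicit Arguments.
Unset Strict Implicit.
Unset Printing Implicit Defensive.

Import GRing.Theory.

(** * Exact covers by bit masks and completeness of the search *)

Section ExactCover.

Definition bits n (l : seq nat) : bitseq :=
  foldr (fun i m => set_nth false m i true) (nseq n false) l.

Lemma nth_bits n l i : nth false (bits n l) i = (i \in l).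
Proof.
elim: l => [|j l IHl] /=; first by rewrite nth_nseq if_same.
by rewrite nth_set_nth /= in_cons IHl; case: eqP.
Qed.

Lemma size_bits n l : all (ltn^~ n) l -> size (bits n l) = n.
Proof.
elim: l => [|j l IHl] /=; first by rewrite size_nseq.
by case/andP=> ltjn /IHl; rewrite size_set_nth => ->; apply/maxn_idPr.
Qed.

(* The masks with bit 0 set, then those whose lowest bit is bit 1, and so on;
   the [i]-th bucket omits the bits 0, ..., i of its masks. *)
Fixpoint buckets n (masks : seq (nat * bitseq)) : seq (seq (nat * bitseq)) :=
  if n is n'.+1 then
    [seq (x.1, behead x.2) | x <- masks & head false x.2]
      :: buckets n' [seq (x.1, behead x.2) | x <- masks & ~~ head false x.2]
  else [::].

Definition minus (free m : bitseq) : bitseq :=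
  [seq x.1 && ~~ x.2 | x <- zip free m].

Definition fits (m free : bitseq) := all2 implb m free.

(* The labels of the families of masks that partition [free]: the lowest free
   bit must be the lowest bit of exactly one mask. *)
Fixpoint search (bs : seq (seq (nat * bitseq))) (free : bitseq) :
    seq (seq nat) :=
  match bs, free with
  | b :: bs', f :: free' =>
    if f then
      flatten [seq (if fits x.2 free' then
                      [seq x.1 :: l | l <- search bs' (minus free' x.2)]
                    else [::]) | x <- b]
    else search bs' free'
  | _, _ => [:: [::]]
  end.

Lemma size_minus free m : size m = size free -> size (minus free m) = size free.
Proof. by move=> eq_sz; rewrite size_map size1_zip // eq_sz. Qed.

Lemma nth_minus free m i : size m = size free ->
  nth false (minus free m) i = nth false free i && ~~ nth false m i.
Proof.
move=> eq_sz; case: (ltnP i (size free)) => [lti|lei].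
  by rewrite (nth_map (false, false)) ?size1_zip ?eq_sz // nth_zip.
by rewrite nth_default ?size_minus // [nth _ free _]nth_default.
Qed.

Lemma fitsP m free : size m = size free ->
  (forall i, nth false m i ==> nth false free i) -> fits m free.
Proof.
rewrite /fits; elim: m free => [|a m IHm] [|f free] //= [eq_sz] sub_mf.
by rewrite (sub_mf 0) IHm // => i; apply: (sub_mf i.+1).
Qed.

(** Induction on the number of bits. If bit 0 is free, exactly one mask of [L] contains it, and the
    search tries that mask; otherwise no mask of [L] does. Either way the other masks of [L] belong
    to later buckets. *)
Lemma search_complete n masks free (L : seq (nat * bitseq)) :
    size free = n -> {in masks, forall x, size x.2 = n} ->
    {subset L <= masks} -> all (fun x => has id x.2) L ->
    (forall i, i < n ->
       count (fun x => nth false x.2 i) L = nth false free i) ->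
  exists2 l, l \in search (buckets n masks) free & perm_eq l (map fst L).
Proof.
elim: n masks free L => [|n IHn] masks free L.
  case: free => // _ sz_masks subL nzL _; exists [::]; rewrite ?inE //.
  (* With no bits left a mask cannot have a set bit, so [L] is empty. *)
  case: L subL nzL => [|x L] //= subL /andP[].
  by rewrite has_count leqNgt ltnS (leq_trans (count_size _ _)) // sz_masks ?subL ?mem_head.
case: free => // f free [sz_free] sz_masks subL nzL cntL /=.
pose tl (x : nat * bitseq) := (x.1, behead x.2).
(* Shared by both cases: once no mask of [L'] contains bit 0, drop this bit everywhere and apply
   induction. *)
have step L' free' : size free' = n -> {subset L' <= L} ->
    all (fun x => ~~ head false x.2) L' ->
    (forall i, i < n ->
       count (fun x => nth false x.2 i.+1) L' = nth false free' i) ->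
  exists2 l, l \in search (buckets n
      [seq tl x | x <- masks & ~~ head false x.2]) free'
    & perm_eq l (map fst L').
  move=> sz_free' subL' hdL' cntL'.
  have [||||i lt_in|l l_s l_p] :=
    IHn [seq tl x | x <- masks & ~~ head false x.2] free' (map tl L').
  - by [].
  - move=> y /mapP[x]; rewrite mem_filter => /andP[_ x_m] -> /=.
    by rewrite size_behead sz_masks.
  - move=> y /mapP[x xL' ->]; apply: map_f; rewrite mem_filter subL ?subL' //.
    by rewrite (allP hdL').
  - apply/allP=> y /mapP[x xL' ->] /=.
    have := allP nzL x (subL' x xL'); have := allP hdL' x xL'.
    by case: (x.2) => [|[]].
  - rewrite count_map -cntL' //; apply: eq_count => x /=.
    by rewrite nth_behead.
  - by exists l => //; rewrite -map_comp in l_p.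
have hd0 (x : nat * bitseq) : nth false x.2 0 = head false x.2 by rewrite nth0.
have := cntL 0 isT; rewrite (eq_count hd0) /=; case: f cntL => /= cntL cnt0.
  have /hasP[x xL hdx] : has (fun x => head false x.2) L.
    by rewrite has_count cnt0.
  have permL := perm_to_rem xL.
  have cnt_rem P : count P L = P x + count P (rem x L).
    by rewrite (permP permL).
  have x_m := subL _ xL.
  have sz_tl : size (behead x.2) = size free.
    by rewrite size_behead sz_masks ?sz_free.
  have [||||l l_s l_p] := step (rem x L) (minus free (behead x.2)).
  - by rewrite size_minus.
  - exact: mem_rem.
  - have := cnt_rem (fun x => head false x.2); rewrite cnt0 hdx => -[/esym/eqP].
    by rewrite -leqn0 leqNgt -has_count -all_predC.
  (* Bit [i.+1] is covered at most once by [L]; if [x] covers it, no other mask does. *)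
  - move=> i lt_in; rewrite nth_minus // nth_behead.
    have := cntL i.+1 lt_in; rewrite cnt_rem /=.
    by case: (nth false x.2 _); case: (nth false free i) => //= -[].
  exists (x.1 :: l); last first.
    by rewrite (permPr (perm_map fst permL)) /= perm_cons.
  apply/flattenP; exists [seq x.1 :: l | l <- search (buckets n
      [seq tl x | x <- masks & ~~ head false x.2]) (minus free (behead x.2))].
    apply/mapP; exists (tl x); first by rewrite map_f // mem_filter hdx.
    rewrite fitsP // => i; rewrite nth_behead.
    case: (ltnP i n) => [lt_in | le_ni]; last first.
      by rewrite nth_default // sz_masks.
    have := cntL i.+1 lt_in; rewrite cnt_rem /=.
    by case: (nth false x.2 _); case: (nth false free i).
  exact: map_f.
apply: step => //; first by move/eqP: cnt0; rewrite -leqn0 leqNgt -has_count -all_predC.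
by move=> i lt_in; apply: (cntL i.+1).
Qed.

End ExactCover.

(** * The executable check on a numbered group *)

Section Check.

Variables (n : nat) (tbl : seq (seq nat)).

Definition addt i j := nth 0 (nth [::] tbl i) j.

Definition translate g S := [seq addt g s | s <- S].

Definition translates S := [seq (g, bits n (translate g S)) | g <- iota 0 n].

(** A complement containing 0 uses [S] itself as a translate, so the search covers only the rest,
    and the label 0 is put back in front. *)
Definition complements S :=
  [seq 0 :: l | l <- search (buckets n (translates S))
                            (minus (nseq n true) (bits n S))].

(** In a 2-group a nontrivial stabiliser contains an element of order 2, so testing only such
    periods loses nothing. *)
Definition involutions := [seq h <- iota 1 n.-1 | addt h h == 0].

Definition periodicb hs C :=
  let m := bits n C in
  has (fun h => all (fun x => nth false m (addt h x)) C) hs.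

Definition tilesb A B :=
  [&& size A * size B == n, all (ltn^~ n) A, all (ltn^~ n) B
    & all id (bits n [seq addt a b | a <- A, b <- B])].

(** For [x] of order 4 this is the subgroup generated by [x], with period [2x]. *)
Definition multiples x := [:: 0; x; addt x x; addt x (addt x x)].

(* Nested conditionals rather than boolean connectives: the virtual machine
   evaluates both arguments of the latter. *)
Definition check_set hs S :=
  if periodicb hs S then true else
  let cs := complements S in
  (if cs is [::] then true
   else has (fun C => if periodicb hs C then tilesb S C else false) cs)
  && all (fun C => if periodicb hs C then true else
       has (fun x => let P := multiples x in
                     if periodicb hs P then tilesb C P else false) S) cs.

(** The ranges give [0 < i < j < k < n], so each 4-element set containing 0 is visited once. *)
Definition check :=
  let hs := involutions in
  all (fun i => all (fun j => all (fun k => check_set hs [:: 0; i; j; k])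
    (iota j.+1 (n - j.+1))) (iota i.+1 (n - i.+1))) (iota 1 n.-1).

End Check.

(** Tabulating the addition turns each sum in the search into a lookup. *)
Definition table n (add : nat -> nat -> nat) :=
  mkseq (fun i => mkseq (add i) n) n.

Local Open Scope ring_scope.

(** * Tilings and periods in finite abelian groups *)

Section Tilings.

Variable G : finZmodType.
Implicit Types A B S T : {set G}.

Lemma tiling_surj A B g : tiling_pair A B ->
  exists a b, [/\ a \in A, b \in B & g = a + b].
Proof. by move/(_ g) => [[a b] [[aA bB ->] _]]; exists a, b. Qed.

Lemma tiling_inj A B a b a' b' : tiling_pair A B ->
  a \in A -> b \in B -> a' \in A -> b' \in B -> a + b = a' + b' ->
  a = a' /\ b = b'.
Proof.
move/(_ (a + b)) => [p [_ uniq_p]] aA bB a'A b'B eq_ab.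
have := uniq_p (a, b) (And3 aA bB erefl).
by rewrite (uniq_p (a', b') (And3 a'A b'B eq_ab)) => -[-> ->].
Qed.

Lemma card_tiling A B : tiling_pair A B -> (#|A| * #|B| = #|G|)%N.
Proof.
move=> tAB; rewrite -cardsX -cardsT.
rewrite -(@card_in_imset _ _ (fun p : G * G => p.1 + p.2)); last first.
  move=> [a b] [a' b'] /setXP[aA bB] /setXP[a'A b'B] /= eq_ab.
  by have [-> ->] := tiling_inj tAB aA bB a'A b'B eq_ab.
apply: eq_card => g; rewrite inE.
have [a [b [aA bB ->]]] := tiling_surj g tAB.
by apply/imsetP; exists (a, b); rewrite ?inE ?aA.
Qed.

(** The sum map from [setX A B] is onto a set at least as large as its domain, hence injective. *)
Lemma tilingI A B : (#|A| * #|B| <= #|G|)%N ->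
    (forall g, exists a b, [/\ a \in A, b \in B & g = a + b]) ->
  tiling_pair A B.
Proof.
move=> leAB surjAB g; have [a [b [aA bB g_ab]]] := surjAB g.
have injAB : {in setX A B &, injective (fun p : G * G => p.1 + p.2)}.
  apply/imset_injP; apply/eqP/anti_leq; rewrite leq_imset_card cardsX.
  rewrite (leq_trans leAB) // -cardsT subset_leq_card //.
  apply/subsetP=> x _; have [c [d [cA dB ->]]] := surjAB x.
  by apply/imsetP; exists (c, d); rewrite ?inE ?cA.
exists (a, b); split=> // -[c d] [/= cA dB g_cd].
by apply: injAB; rewrite ?inE ?aA ?cA //= -g_ab.
Qed.

Lemma tiling_sym A B : tiling_pair A B -> tiling_pair B A.
Proof.
move=> tAB; apply: tilingI => [|g]; first by rewrite mulnC card_tiling.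
by have [a [b [aA bB ->]]] := tiling_surj g tAB; exists b, a; rewrite addrC.
Qed.

Lemma tiling_shift A B g : tiling_pair A B -> tiling_pair [set a + g | a in A] B.
Proof.
move=> tAB; apply: tilingI => [|x].
  by rewrite card_imset ?card_tiling //; apply: addIr.
have [a [b [aA bB x_ab]]] := tiling_surj (x - g) tAB.
by exists (a + g), b; rewrite (imset_f (fun a => a + g)) // addrAC -x_ab subrK.
Qed.

Lemma shiftK A g : [set a - g | a in [set a + g | a in A]] = A.
Proof.
by rewrite -imset_comp (eq_imset (g := id)) ?imset_id // => a /=; rewrite addrK.
Qed.

Lemma periodic_shift A g : periodic [set a + g | a in A] -> periodic A.
Proof.
case=> nzA [h nz_h per_h]; split.
  by apply: contra nzA => /eqP->; rewrite imset0.
exists h => //; rewrite -{2}(shiftK A g) -per_h -!imset_comp.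
by apply: eq_imset => a /=; rewrite addrAC addrK.
Qed.

(** Translation preserves cardinality, so the inclusion of [A + g] in [A] is an equality. *)
Lemma periodicI A g : A != set0 -> g != 0 -> {in A, forall a, a + g \in A} ->
  periodic A.
Proof.
move=> nzA nz_g per_g; split=> //; exists g => //.
apply/eqP; rewrite eqEcard card_imset ?leqnn ?andbT; last exact: addIr.
by apply/subsetP=> _ /imsetP[a aA ->]; apply: per_g.
Qed.

Lemma tiling_neq0 A B : tiling_pair A B -> A != set0.
Proof.
by move/(tiling_surj 0) => [a [_ [aA _ _]]]; apply/set0Pn; exists a.
Qed.

Lemma periodic_setT : (1 < #|G|)%N -> periodic [set: G].
Proof.
move=> gt1; have /card_gt1P[x [y [_ _ neq_xy]]] := gt1.
apply: (@periodicI _ (x - y)) => [||a _]; rewrite ?inE ?subr_eq0 //.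
by apply/set0Pn; exists 0; rewrite inE.
Qed.

Lemma periodic_pair A B : tiling_pair A B -> #|A| = 2 ->
  periodic A \/ periodic B.
Proof.
move=> tAB /eqP/cards2P[x [y [neq_xy defA]]]; pose d := x - y.
have nz_d : d != 0 by rewrite subr_eq0.
have y_d : y + d = x by rewrite addrC subrK.
have [xA yA] : x \in A /\ y \in A by rewrite defA !inE !eqxx orbT.
have [d2_0|nz_d2] := eqVneq (d + d) 0; [left | right].
  apply: (@periodicI A d (tiling_neq0 tAB) nz_d) => a; rewrite {1}defA !inE.
  by case/orP=> /eqP->; rewrite ?y_d // -y_d -addrA d2_0 addr0.
apply: periodicI (tiling_neq0 (tiling_sym tAB)) nz_d2 _ => b bB.
(* If [a = x], then [b' = b + d] and [y + b' = x + b], against uniqueness. So [a = y], and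
   [x = y + d] gives [b' = b + 2d]. *)
have [a [b' [aA b'B]]] := tiling_surj (b + d + x) tAB.
rewrite {1}defA !inE in aA; case/orP: aA => /eqP->.
  rewrite (addrC x) => /addIr b'_bd; rewrite -b'_bd in b'B.
  have [] := tiling_inj tAB yA b'B xA bB; first by rewrite addrCA y_d addrC.
  by move/eqP; rewrite eq_sym (negPf neq_xy).
move=> eq_b'; have -> // : b + (d + d) = b'.
by apply: (addrI y); rewrite -eq_b' addrC -addrA -(addrA d) (addrC d y) y_d addrA.
Qed.

End Tilings.

(** * Numberings of a group that make its addition computable *)

Record coding (G : finZmodType) (n : nat) (add : nat -> nat -> nat)
    (c : G -> nat) : Prop := Coding {
  code_inj : injective c;
  code_lt : forall x, (c x < n)%N;
  code_onto : forall i, (i < n)%N -> exists x, c x = i;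
  code0 : c 0 = 0%N;
  codeD : forall x y, c (x + y) = add (c x) (c y) }.

Lemma coding_Zp p : @coding 'Z_p.+2 p.+2 (fun i j => (i + j) %% p.+2)%N val.
Proof.
split=> //; [exact: val_inj | exact: ltn_ord |].
by move=> i lti; exists (Ordinal lti).
Qed.

(** Mixed radix: quotient and remainder by [n] recover the codes of the two components. *)
Lemma coding_prod (G H : finZmodType) m n add1 add2 c1 c2 :
    @coding G m add1 c1 -> @coding H n add2 c2 ->
  @coding (G * H)%type (m * n)%N
    (fun i j => add1 (i %/ n) (j %/ n) * n + add2 (i %% n) (j %% n))%N
    (fun x => c1 x.1 * n + c2 x.2)%N.
Proof.
move=> C1 C2.
have n_gt0 : (0 < n)%N by apply: leq_ltn_trans (code_lt C2 0).
have divc x : ((c1 x.1 * n + c2 x.2) %/ n = c1 x.1)%N.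
  by rewrite divnMDl // (divn_small (code_lt C2 _)) addn0.
have modc x : ((c1 x.1 * n + c2 x.2) %% n = c2 x.2)%N.
  by rewrite modnMDl (modn_small (code_lt C2 _)).
split.
- move=> [x y] [x' y'] /= eq_c; congr (_, _).
    by apply: (code_inj C1); rewrite -(divc (x, y)) -(divc (x', y')) /= eq_c.
  by apply: (code_inj C2); rewrite -(modc (x, y)) -(modc (x', y')) /= eq_c.
- move=> x; apply: leq_trans (_ : (c1 x.1).+1 * n <= _)%N; last first.
    by rewrite leq_mul2r (code_lt C1) orbT.
  by rewrite mulSnr ltn_add2l (code_lt C2).
- move=> i lt_i; have [|x c1x] := code_onto C1 (i := i %/ n)%N.
    by rewrite ltn_divLR.
  have [|y c2y] := code_onto C2 (i := i %% n)%N; first by rewrite ltn_mod.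
  by exists (x, y); rewrite /= c1x c2y -divn_eq.
- by rewrite /= (code0 C1) (code0 C2).
- by move=> x y; rewrite !divc !modc /= (codeD C1) (codeD C2).
Qed.

(** * From the executable check to statements about tilings *)

Section CheckSound.

Variables (G : finZmodType) (n : nat) (add : nat -> nat -> nat) (c : G -> nat).
Hypothesis Gc : coding n add c.
Implicit Types (S T : {set G}) (A B C sS : seq nat).

Local Notation tbl := (table n add).

Definition decode C : {set G} := [set x | c x \in C].

Lemma addtE x y : addt tbl (c x) (c y) = c (x + y).
Proof. by rewrite /addt !nth_mkseq ?(code_lt Gc) // (codeD Gc). Qed.

Lemma card_coding : #|G| = n.
Proof.
rewrite cardE -(size_map c) -[RHS](size_iota 0); apply: perm_size.
apply: uniq_perm; rewrite ?iota_uniq ?(map_inj_uniq (code_inj Gc)) ?enum_uniq //.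
move=> i; rewrite mem_iota add0n; apply/mapP/idP => [[x _ ->]|lt_in].
  exact: (code_lt Gc).
by have [x <-] := code_onto Gc lt_in; exists x; rewrite ?mem_enum.
Qed.

(** Only a bound, since the list may contain repetitions or numbers that code no element. *)
Lemma card_decode C : (#|decode C| <= size C)%N.
Proof.
rewrite cardE -(size_map c) uniq_leq_size //.
  by rewrite (map_inj_uniq (code_inj Gc)) enum_uniq.
by move=> _ /mapP[x xC ->]; move: xC; rewrite mem_enum inE.
Qed.

Lemma periodicb_sound C : decode C != set0 ->
  periodicb n tbl (involutions n tbl) C -> periodic (decode C).
Proof.
move=> nzC /hasP[h]; rewrite mem_filter mem_iota => /and3P[_ h_gt0 h_lt] /allP perC.
have [|g def_h] := code_onto Gc (i := h); first by lia.
apply: (periodicI (g := g) nzC).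
  by apply: contraTneq h_gt0 => g0; rewrite -def_h g0 (code0 Gc).
move=> a; rewrite !inE => /perC.
by rewrite nth_bits -def_h addtE addrC.
Qed.

Lemma tilesb_sound A B :
  tilesb n tbl A B -> tiling_pair (decode A) (decode B).
Proof.
case/and4P=> /eqP szAB /allP ltA /allP ltB /all_nthP cover.
apply: tilingI => [|g].
  by rewrite card_coding -szAB leq_mul ?card_decode.
have := cover false (c g); rewrite size_bits; last first.
  apply/allP=> _ /allpairsP[[a b] [/= /ltA lta /ltB ltb ->]].
  have [x <-] := code_onto Gc lta; have [y <-] := code_onto Gc ltb.
  by rewrite addtE (code_lt Gc).
rewrite nth_bits => /(_ (code_lt Gc g)) /allpairsP[[a b] [/= aA bB]].
have [x def_x] := code_onto Gc (ltA a aA).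
have [y def_y] := code_onto Gc (ltB b bB).
rewrite -def_x -def_y addtE => /(code_inj Gc) ->.
by exists x, y; rewrite !inE def_x def_y.
Qed.

(** The translates of [decode sS] by the nonzero elements of [T] partition the complement of
    [decode sS], so their labels are found by the search. *)
Lemma complements_complete sS T : all (ltn^~ n) sS ->
    tiling_pair (decode sS) T -> 0 \in decode sS -> 0 \in T ->
  exists2 C, C \in complements n tbl sS & decode C = T.
Proof.
move=> lt_sS tST S0 T0.
have trE t s : s \in translate tbl (c t) sS ->
    exists2 x, x \in decode sS & s = c (t + x).
  case/mapP=> i iS ->; have [x def_i] := code_onto Gc (allP lt_sS i iS).
  by exists x; rewrite ?inE ?def_i // -def_i addtE.
have mem_tr t y : (c y \in translate tbl (c t) sS) = (y - t \in decode sS).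
  apply/idP/idP => [/trE[x xS /(code_inj Gc) ->]|]; first by rewrite addrAC subrr add0r.
  by rewrite inE => ytS; apply/mapP; exists (c (y - t)); rewrite ?addtE // addrC subrK.
have sz_tr t : size (bits n (translate tbl (c t) sS)) = n.
  by apply: size_bits; apply/allP=> s /trE[x _ ->]; exact: (code_lt Gc).
pose L := [seq (c t, bits n (translate tbl (c t) sS)) | t <- enum (T :\ 0)].
have [||||i lt_in|l l_s l_p] := @search_complete n (translates n tbl sS)
    (minus (nseq n true) (bits n sS)) L.
- by rewrite size_minus ?size_nseq // size_bits.
- move=> _ /mapP[g g_lt ->] /=; move: g_lt; rewrite mem_iota => /andP[_ g_lt].
  by have [t <-] := code_onto Gc g_lt.
- move=> _ /mapP[t _ ->]; apply: map_f.
  by rewrite mem_iota (code_lt Gc).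
- apply/allP=> _ /mapP[t _ ->]; apply/(has_nthP false); exists (c t) => /=.
    by rewrite sz_tr (code_lt Gc).
  by rewrite nth_bits mem_tr subrr.
(* Writing [y = s + t], the only translate containing [y] is the one by [t]. It is listed in [L]
   exactly when [t] is nonzero, that is, when [y] is outside [decode sS]. *)
- have [y def_i] := code_onto Gc lt_in.
  have [s [t [sS_s tT y_st]]] := tiling_surj y tST.
  rewrite nth_minus ?size_nseq ?size_bits // nth_nseq lt_in nth_bits /=.
  rewrite count_map (eq_in_count (a2 := pred1 t)) => [|u]; last first.
    rewrite mem_enum !inE => /andP[_ uT] /=; rewrite nth_bits -def_i mem_tr.
    apply/idP/eqP=> [yuS|->]; last by rewrite y_st addrK.
    by have [] := tiling_inj tST yuS uT sS_s tT; rewrite ?subrK.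
  rewrite count_uniq_mem ?enum_uniq // mem_enum !inE tT andbT; congr (nat_of_bool (~~ _)).
  rewrite -def_i; apply/eqP/idP=> [t0 | yS].
    by move: sS_s; rewrite inE y_st t0 addr0.
  have [||_ ->//] := tiling_inj tST (_ : y \in decode sS) T0 sS_s tT.
    by rewrite inE.
  by rewrite addr0.
exists (0%N :: l); first exact: map_f.
apply/setP=> x; rewrite inE in_cons (perm_mem l_p) -map_comp.
rewrite -[in X in X || _](code0 Gc) (inj_eq (code_inj Gc)).
rewrite (mem_map (code_inj Gc)) mem_enum !inE.
by have [->|] := eqVneq x 0.
Qed.

(** The conjunction serves both roles of a 4-element factor: its first half replaces [T] when that
    factor comes first in the pair, its second half replaces that factor when it comes second. *)
Lemma check_set_sound sS T :
    all (ltn^~ n) sS -> check_set n tbl (involutions n tbl) sS ->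
    tiling_pair (decode sS) T -> 0 \in decode sS -> 0 \in T ->
  periodic (decode sS) \/
  (exists2 T', periodic T' & tiling_pair (decode sS) T') /\
  (periodic T \/ exists2 S', periodic S' & tiling_pair S' T).
Proof.
move=> lt_sS; rewrite /check_set.
case: ifP => [perS _ tST _ _ | _ chk tST S0 T0].
  by left; apply: periodicb_sound perS; apply: tiling_neq0 tST.
right; have [C C_cs def_T] := complements_complete lt_sS tST S0 T0.
case/andP: chk => has_per /allP/(_ C C_cs) chkC; split.
  (* The code [C] of [T] shows that the list of complements is nonempty. *)
  have /hasP[D _] : has (fun C => if periodicb n tbl (involutions n tbl) C
      then tilesb n tbl sS C else false) (complements n tbl sS).
    by case: (complements _ _ _) C_cs has_per.
  case: ifP => // perD /tilesb_sound tSD; exists (decode D) => //.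
  by apply: periodicb_sound perD; apply: tiling_neq0 (tiling_sym tSD).
case: ifP chkC => [perC _|_ /hasP[x _]].
  left; rewrite -def_T; apply: periodicb_sound perC.
  by rewrite def_T; apply: tiling_neq0 (tiling_sym tST).
case: ifP => // perP /tilesb_sound tTP; rewrite def_T in tTP.
right; exists (decode (multiples tbl x)); last exact: tiling_sym.
by apply: periodicb_sound perP; apply: tiling_neq0 (tiling_sym tTP).
Qed.

(** Sorting the codes of [S] gives a strictly increasing list whose first entry is the code 0. *)
Lemma decode4 S : #|S| = 4 -> 0 \in S ->
  exists i j k, [/\ (0 < i < j)%N, (j < k < n)%N & decode [:: 0; i; j; k]%N = S].
Proof.
move=> S4 S0; pose s := sort leq [seq c x | x <- enum S].
have s_mem x : (c x \in s) = (x \in S).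
  by rewrite mem_sort (mem_map (code_inj Gc)) mem_enum.
have s_lt : all (ltn^~ n) s.
  by apply/allP=> i; rewrite mem_sort => /mapP[x _ ->]; exact: (code_lt Gc).
have s_sorted : sorted ltn s.
  rewrite ltn_sorted_uniq_leq sort_sorted; last exact: leq_total.
  by rewrite sort_uniq (map_inj_uniq (code_inj Gc)) enum_uniq.
have s0 : 0%N \in s by rewrite -(code0 Gc) s_mem.
have : size s = 4 by rewrite size_sort size_map -cardE.
case: s s_mem s_lt s_sorted s0 => [|a [|i [|j [|k []]]]] //= s_mem.
rewrite !inE => /and5P[_ _ _ lt_k _] /and4P[lt_ai lt_ij lt_jk _] s0 _.
have a0 : a = 0%N by move: s0 lt_ai lt_ij lt_jk; lia.
exists i, j, k; rewrite -a0 lt_ai lt_ij lt_jk lt_k; split=> //.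
by apply/setP=> x; rewrite inE s_mem.
Qed.

Lemma check_sound S T : check n tbl -> tiling_pair S T -> #|S| = 4 ->
  periodic S \/
  (exists2 T', periodic T' & tiling_pair S T') /\
  (periodic T \/ exists2 S', periodic S' & tiling_pair S' T).
Proof.
move=> chk tST S4.
have [s [t [sS tT _]]] := tiling_surj 0 tST.
(* Normalise both factors to contain 0; tilings and periodicity survive translation, and the
   replacements found are translated back as needed. *)
have tST' := tiling_shift (- t) (tiling_sym (tiling_shift (- s) tST)).
move/tiling_sym: tST'.
set S' := [set _ | _ in S]; set T' := [set _ | _ in T] => tST'.
have S'0 : 0 \in S' by apply/imsetP; exists s; rewrite ?subrr.
have T'0 : 0 \in T' by apply/imsetP; exists t; rewrite ?subrr.
have [|i [j [k [/andP[i0 ij] /andP[jk kn] def_S']]]] := decode4 _ S'0.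
  by rewrite card_imset //; apply: addIr.
have [|||||perS'|[[T1 perT1 tT1] perT]] := @check_set_sound [:: 0; i; j; k]%N T'.
- by rewrite /=; lia.
- have i_in : i \in iota 1 n.-1 by rewrite mem_iota; lia.
  have j_in : j \in iota i.+1 (n - i.+1) by rewrite mem_iota; lia.
  have k_in : k \in iota j.+1 (n - j.+1) by rewrite mem_iota; lia.
  exact: allP (allP (allP chk i i_in) j j_in) k k_in.
- by rewrite def_S'.
- by rewrite def_S'.
- by [].
- by left; rewrite def_S' in perS'; apply: periodic_shift perS'.
right; split.
  exists T1 => //; rewrite def_S' in tT1.
  by have := tiling_shift s tT1; rewrite -{1}(opprK s) shiftK.
case: perT => [perT'|[S1 perS1 tS1]]; [left | right].
  exact: periodic_shift perT'.
exists S1 => //; have := tiling_shift t (tiling_sym tS1).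
by rewrite -{1}(opprK t) shiftK => /tiling_sym.
Qed.

End CheckSound.

(** * Groups of order 32 and the two computations *)

Lemma PT_order32 (G : finZmodType) add c :
  @coding G 32 add c -> check 32 (table 32 add) -> PT_property G.
Proof.
move=> Gc chk A B tAB.
have cardG := card_coding Gc; have := card_tiling tAB; rewrite cardG => cAB.
have per_full (D : {set G}) : #|D| = 32 -> periodic D.
  move=> cD; have -> : D = setT by apply/eqP; rewrite eqEcard subsetT cardsT cardG cD.
  by apply: periodic_setT; rewrite cardG.
have : #|A| \in divisors 32 by rewrite -dvdn_divisors // -cAB dvdn_mulr.
rewrite (_ : divisors 32 = [:: 1; 2; 4; 8; 16; 32]%N) // !inE.
do 5?[case/orP]; move/eqP=> cA; rewrite cA in cAB.
- by right; exists B => //; apply: per_full; lia.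
- by case: (periodic_pair tAB cA) => perD; [left | right; exists B].
- by case: (check_sound Gc chk tAB cA) => [|[]]; [left | right].
- have cB : #|B| = 4 by lia.
  (* Here the 4-element factor is [B], so the check is applied to the swapped pair and the second
     half of its conclusion is used. *)
  case: (check_sound Gc chk (tiling_sym tAB) cB) => [perB|[_ [perA|[S1 perS1 tS1]]]].
  + by right; exists B.
  + by left.
  + by right; exists S1 => //; apply: tiling_sym.
- have cB : #|B| = 2 by lia.
  by case: (periodic_pair (tiling_sym tAB) cB) => perD; [right; exists B | left].
- by left; apply: per_full.
Qed.

Theorem theorem1p6 :
  PT_property ('Z_8 * 'Z_4)%type /\ PT_property ('Z_4 * 'Z_4 * 'Z_2)%type.
Proof.
split.
  (* [coding_Zp p] codes the cyclic group of order [p + 2]: 6 and 2 stand for orders 8 and 4, and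
     below 0 stands for order 2. *)
  have Gc := coding_prod (coding_Zp 6) (coding_Zp 2).
  apply: (PT_order32 Gc).
  (* The whole search runs by kernel evaluation of [check]. *)
  vm_cast_no_check (erefl true).
have Gc := coding_prod (coding_prod (coding_Zp 2) (coding_Zp 2)) (coding_Zp 0).
apply: (PT_order32 Gc).
vm_cast_no_check (erefl true).
Qed.
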